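(* (One-dimensional case) Let $k>0$. Then $$h_t(x,x)\asymp\mu(B(x,\sqrt t))^{-1}\quad\text{and}\quad h_t(x,-x)\asymp\mu(B(x,\sqrt t))^{-1}\,\frac{t}{t+x^2}$$ for every $t>0$ and $x\in\mathbb{R}$. (Product case) Let $n\ge1$ and $k_1,\dots,k_n>0$. Then $$\mathbf{h}_t(\mathbf{x},\mathbf{y})\asymp\boldsymbol{\mu}(B(\mathbf{x},\sqrt t))^{-1}\,\frac{t}{t+|\mathbf{x}-\mathbf{y}|^2}$$ for every $t>0$, $\mathbf{x}\in\mathbb{R}^n$ and $\mathbf{y}=(-x_1,x_2,\dots,x_n)$.
   Context: The notation $f\asymp g$ means that there is a constant $C>0$, depending only on the multiplicities (and $n$), with $C^{-1}g\le f\le C g$ throughout the indicated range. $B(\mathbf{x},r)$ denotes the Euclidean ball of center $\mathbf{x}$ and radius $r$. For $k>0$: $d\mu(x)=|x|^{2k}dx$ on $\mathbb{R}$, $$E_k(x,y)=\frac{\Gamma(k+\frac12)}{\Gamma(k)\,\Gamma(\frac12)}\int_{-1}^{1}(1-u)^{k-1}(1+u)^k e^{xyu}\,du,$$ and the one-dimensional heat kernel is $$h_t(x,y)=c_k^{-1}\,t^{-k-\frac12}\,e^{-\frac{x^2+y^2}{4t}}\,E_k\Bigl(\frac{x}{\sqrt{2t}},\frac{y}{\sqrt{2t}}\Bigr),\qquad c_k=2^{2k+1}\Gamma(k+\tfrac12).$$ In the product case, $d\boldsymbol{\mu}(\mathbf{x})=\prod_{j=1}^n|x_j|^{2k_j}dx_j$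 and $\mathbf{h}_t(\mathbf{x},\mathbf{y})=\prod_{j=1}^nh_t^{(j)}(x_j,y_j)$, where $h_t^{(j)}$ is the one-dimensional heat kernel with $k=k_j$. *)

(* Defs.v *)
From HB Require Import structures.
From mathcomp Require Import all_boot all_order all_algebra.
From mathcomp Require Import all_classical all_reals all_analysis.

Set Implicit Arguments.
Unset Strict Implicit.
Unset Printing Implicit Defensive.

Import Order.TTheory GRing.Theory Num.Theory.
Import numFieldNormedType.Exports.

Local Open Scope classical_set_scope.
Local Open Scope ring_scope.

Section one_dimensional.
Context {R : realType}.
Implicit Types (a k t x y u : R) (A : set R).

Definition gamma_fun a : R :=
  \int[lebesgue_measure]_(x in `]0, +oo[) (x `^ (a - 1) * expR (- x)).

Definition dunkl_measure1 k A : \bar R :=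
  (\int[lebesgue_measure]_(x in A) (`|x| `^ (2 * k))%:E)%E.

(* For k < 1 the true integrand blows up at u = 1, where powR returns 0; this
   changes the integrand only on a null set. *)
Definition dunkl_kernel1 k x y : R :=
  gamma_fun (k + 2^-1) / (gamma_fun k * gamma_fun 2^-1) *
  \int[lebesgue_measure]_(u in `[-1, 1])
    ((1 - u) `^ (k - 1) * (1 + u) `^ k * expR (x * y * u)).

Definition heat_cst k : R := 2 `^ (2 * k + 1) * gamma_fun (k + 2^-1).

Definition heat_kernel1 k t x y : R :=
  (heat_cst k)^-1 * t `^ (- k - 2^-1) *
  expR (- ((x ^+ 2 + y ^+ 2) / (4 * t))) *
  dunkl_kernel1 k (x / Num.sqrt (2 * t)) (y / Num.sqrt (2 * t)).

End one_dimensional.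

Section lebesgue_measure_on_tuples.
Context {R : realType}.
Local Open Scope ereal_scope.
Local Notation rT := (measurableTypeR R).

Definition tcons n (p : rT * n.-tuple rT) : n.+1.-tuple rT :=
  [the n.+1.-tuple rT of p.1 :: p.2].

Lemma measurable_tcons n : measurable_fun [set: rT * n.-tuple rT] (@tcons n).
Proof. exact: measurable_cons. Qed.

(* Lebesgue measure on R^n, as an iterated product measure. lebesgue_measure
   lives on measurableTypeR R, a type convertible to R. *)
Fixpoint lebesgue_tuple (n : nat) : set (n.-tuple rT) -> \bar R :=
  match n with
  | 0%N => \d_ ([tuple] : 0.-tuple rT)
  | n'.+1 => pushforward (lebesgue_measure \x @lebesgue_tuple n') (@tcons n')
  end.

Section step.
Context n (m : {sigma_finite_measure set (n.-tuple rT) -> \bar R}).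

Let nu : set (n.+1.-tuple rT) -> \bar R :=
  pushforward (lebesgue_measure \x m) (@tcons n).

Let mtcons A : measurable A -> measurable (@tcons n @^-1` A).
Proof. by move=> mA; rewrite -[X in measurable X]setTI; exact: measurable_tcons. Qed.

Let nu0 : nu set0 = 0.
Proof. by rewrite /nu /pushforward preimage_set0 measure0. Qed.

Let nu_ge0 A : 0 <= nu A.
Proof. exact: (measure_ge0 (lebesgue_measure \x m : {measure set _ -> \bar R})). Qed.

Let nu_sigma_additive : semi_sigma_additive nu.
Proof.
move=> F mF tF mUF; rewrite /nu /pushforward preimage_bigcup.
apply: measure_semi_sigma_additive.
- by move=> i; exact: mtcons.
- apply/trivIsetP => /= i j _ _ ij; rewrite -preimage_setI.
  by move/trivIsetP : tF => /(_ _ _ _ _ ij) ->//; rewrite preimage_set0.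
- by rewrite -preimage_bigcup; exact: mtcons.
Qed.

Let nu_sigma_finite : sigma_finite setT nu.
Proof.
have [G GT Goo] := sigma_finiteT (@lebesgue_measure R).
have [H HT Hoo] := sigma_finiteT m.
pose s (x : n.+1.-tuple rT) : rT * n.-tuple rT :=
  (thead x, [tuple of behead x]).
have ms : measurable_fun setT s.
  apply/measurable_fun_pair; first exact: measurable_tnth.
  exact: measurable_behead.
have tconsK : cancel (@tcons n) s.
  by move=> [a u]; rewrite /s /tcons/=; congr pair; apply: val_inj.
pose h i : nat * nat := odflt (0, 0)%N (unpickle i).
exists (fun i => s @^-1` (G (h i).1 `*` H (h i).2)).
  apply/esym; rewrite -subTset => x _.
  have [i _ Gi] : (\bigcup_i G i) (s x).1 by rewrite -GT.
  have [j _ Hj] : (\bigcup_j H j) (s x).2 by rewrite -HT.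
  by exists (pickle (i, j)) => //=; rewrite /h pickleK.
move=> i; have [mG Gi] := Goo (h i).1; have [mH Hi] := Hoo (h i).2; split.
  by rewrite -[X in measurable X]setTI; apply: ms => //; exact: measurableX.
rewrite /nu /pushforward -comp_preimage.
rewrite (_ : s \o @tcons n = id); last by apply/funext => p /=; exact: tconsK.
by rewrite preimage_id product_measure1E// lte_mul_pinfty// ge0_fin_numE.
Qed.

Lemma sigma_finite_tcons :
  exists m' : {sigma_finite_measure set (n.+1.-tuple rT) -> \bar R},
    m' = pushforward (lebesgue_measure \x m) (@tcons n) :> (set _ -> \bar R).
Proof.
pose nuM : {measure set (n.+1.-tuple rT) -> \bar R} :=
  HB.pack nu (isMeasure.Build _ _ _ nu nu0 nu_ge0 nu_sigma_additive).
pose nuS : {sigma_finite_measure set (n.+1.-tuple rT) -> \bar R} :=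
  HB.pack nu (Measure.class nuM)
    (Measure_isSigmaFinite.Build _ _ _ nuM nu_sigma_finite).
by exists nuS.
Qed.

End step.

Lemma lebesgue_tuple_sigma_finite_measure n :
  exists m : {sigma_finite_measure set (n.-tuple rT) -> \bar R},
    m = @lebesgue_tuple n :> (set _ -> \bar R).
Proof.
elim: n => [|n [m mE]]; first by exists (\d_ ([tuple] : 0.-tuple rT)).
by rewrite /= -mE; exact: sigma_finite_tcons.
Qed.

Let lebesgue_tuple0 n : @lebesgue_tuple n set0 = 0.
Proof. by have [m <-] := lebesgue_tuple_sigma_finite_measure n. Qed.

Let lebesgue_tuple_ge0 n A : 0 <= @lebesgue_tuple n A.
Proof. by have [m <-] := lebesgue_tuple_sigma_finite_measure n. Qed.

Let lebesgue_tuple_sigma_additive n : semi_sigma_additive (@lebesgue_tuple n).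
Proof.
have [m <-] := lebesgue_tuple_sigma_finite_measure n.
exact: measure_semi_sigma_additive.
Qed.

HB.instance Definition _ n := isMeasure.Build _ _ _ (@lebesgue_tuple n)
  (@lebesgue_tuple0 n) (@lebesgue_tuple_ge0 n) (@lebesgue_tuple_sigma_additive n).

Let lebesgue_tuple_sigma_finite n : sigma_finite setT (@lebesgue_tuple n).
Proof.
by have [m <-] := lebesgue_tuple_sigma_finite_measure n; exact: sigma_finiteT.
Qed.

HB.instance Definition _ n := Measure_isSigmaFinite.Build _ _ _
  (@lebesgue_tuple n) (@lebesgue_tuple_sigma_finite n).

Lemma lebesgue_tuple_box n (A : 'I_n -> set rT) :
  (forall i, measurable (A i)) ->
  @lebesgue_tuple n [set x | forall i, A i (tnth x i)] =
  \prod_(i < n) lebesgue_measure (A i).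
Proof.
elim: n A => [|n IH] A mA /=.
  rewrite big_ord0 diracE mem_set//= => i; by case: i.
pose B : set (n.-tuple rT) := [set x | forall i, A (lift ord0 i) (tnth x i)].
have mB : measurable B.
  rewrite (_ : B = \bigcap_(i in [set: 'I_n])
      ((fun x : n.-tuple rT => tnth x i) @^-1` A (lift ord0 i))); last first.
    by apply/seteqP; split=> x /= h i; [move=> _; exact: h|exact: (h i)].
  apply: fin_bigcap_measurable => //= i _.
  by rewrite -[X in measurable X]setTI; exact: measurable_tnth.
rewrite /pushforward (_ : _ @^-1` _ = A ord0 `*` B).
  by rewrite product_measure1E// big_ord_recl -(IH (fun i => A (lift ord0 i))).
apply/seteqP; split=> -[a u] /=.
  move=> h; split=> [|i]; first exact: (h ord0).
  by have := h (lift ord0 i); rewrite tnthS.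
by move=> [Aa Bu] i; case: (unliftP ord0 i) => [j|] ->//; rewrite tnthS; exact: Bu.
Qed.

End lebesgue_measure_on_tuples.
Arguments lebesgue_tuple {R} n _.

Section product_case.
Context {R : realType} {n : nat}.
Implicit Types (k : 'I_n -> R) (x y : n.-tuple R) (t r : R).

Definition eucl_dist x y : R :=
  Num.sqrt (\sum_(j < n) (tnth x j - tnth y j) ^+ 2).

Definition eucl_ball x r : set (n.-tuple R) := [set y | eucl_dist x y < r].

Definition dunkl_measure k (A : set (n.-tuple R)) : \bar R :=
  (\int[lebesgue_tuple n]_(x in A)
     (\prod_(j < n) `|tnth x j| `^ (2 * k j))%:E)%E.

Definition heat_kernel k t x y : R :=
  \prod_(j < n) heat_kernel1 (k j) t (tnth x j) (tnth y j).

Definition flip_first x : n.-tuple R :=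
  [tuple if j == 0%N :> nat then - tnth x j else tnth x j | j < n].

End product_case.

(* Main.v *)
Require Import Defs.
From mathcomp Require Import all_boot all_order all_algebra.
From mathcomp Require Import all_classical all_reals all_analysis.
(* Imported last, so that its measurable structure on the extended reals is the
   one inferred. *)
From mathcomp Require Import measurable_realfun.
From mathcomp Require Import ring lra.
Import Order.TTheory GRing.Theory Num.Theory.
Import numFieldNormedType.Exports.
Local Open Scope classical_set_scope.
Local Open Scope ring_scope.

Set Implicit Arguments.
Unset Strict Implicit.
Unset Printing Implicit Defensive.

(** Put z = x^2 / (2t). On the diagonal and on the antidiagonal the Gaussian
    factor of the heat kernel is exactly exp(-z), so that, after the reflection
    u -> -u in the antidiagonal case, h_t(x,x) and h_t(x,-x) are constant
    multiples of t^(-k-1/2) times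

      int_[-1,1] (1-u)^p (1+u)^q exp(-z(1-u)) du,

    with (p,q) = (k-1,k) and (p,q) = (k,k-1) respectively. This integral is
    comparable to (1+z)^(-(p+1)) uniformly in z >= 0 (jacobi_laplace_asymp):
    for large z only the distances 1-u of order 1/z matter, where (1+u)^q is
    bounded above and below, and near u = -1 that factor is integrable because
    q > -1. The extra power of 1-u on the
    antidiagonal is what yields the additional factor t/(t+x^2).

    On the other side, the measure of the ball of radius sqrt t at x is
    comparable to sqrt t (|x| + sqrt t)^(2k) (dunkl_measure1_asymp): the weight
    is at most (|x| + sqrt t)^(2k) on the ball, and at least a constant multiple
    of that at the points of the ball lying at distance at least (sqrt t)/2 from
    x on the side away from the origin. Since t(1+z) is comparable to
    (|x| + sqrt t)^2, the two sides match.

    In dimension n the Euclidean ball of radius sqrt t lies between two boxes with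
    sides of order sqrt t, on which the weight factorizes; hence its measure is
    comparable to the product of the one-dimensional models
    (dunkl_measure_asymp). The heat kernel is a product of one antidiagonal
    factor and n-1 diagonal ones, and |x-y|^2 = 4 x_1^2. *)

(** * Two-sided estimates *)

(** Positivity of g is part of the relation, which makes it an equivalence
    compatible with products, inverses and real powers without side conditions. *)
Definition asymp {R : realType} {I : Type} (D : set I) (f g : I -> R) :=
  exists2 C, 0 < C & forall i, D i -> 0 < g i /\ C^-1 * g i <= f i <= C * g i.

Section asymp.
Context {R : realType}.

Lemma asymp_bounds (I : Type) (D : set I) (f g : I -> R) (c C : R) :
  0 < c -> 0 < C -> (forall i, D i -> 0 < g i) ->
  (forall i, D i -> c * g i <= f i) -> (forall i, D i -> f i <= C * g i) ->
  asymp D f g.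
Proof.
move=> c0 C0 g0 lo up; have M0 : 0 < Num.max c^-1 C by rewrite lt_max C0 orbT.
exists (Num.max c^-1 C) => // i Di; split; first exact: g0.
have gi0 := ltW (g0 _ Di); apply/andP; split.
  apply: le_trans (lo _ Di); rewrite ler_wpM2r// invf_ple//.
  by rewrite le_max lexx.
by apply: (le_trans (up _ Di)); rewrite ler_wpM2r// le_max lexx orbT.
Qed.

Lemma asymp_sym (I : Type) (D : set I) (f g : I -> R) :
  asymp D f g -> asymp D g f.
Proof.
move=> [C C0 fg]; exists C => // i /fg[g0 /andP[lo up]]; split.
  by apply: lt_le_trans lo; rewrite mulr_gt0// invr_gt0.
by rewrite ler_pdivrMl// up/= -ler_pdivrMl.
Qed.

Lemma asymp_pos (I : Type) (D : set I) (f g : I -> R) :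
  asymp D f g -> forall i, D i -> 0 < f i.
Proof. by move/asymp_sym => [C _ h] i /h[]. Qed.

Lemma asymp_refl (I : Type) (D : set I) (f g : I -> R) :
  (forall i, D i -> 0 < g i) -> (forall i, D i -> f i = g i) -> asymp D f g.
Proof.
by move=> g0 fg; exists 1 => // i Di; rewrite g0// fg// invr1 mul1r lexx.
Qed.

Lemma asymp_eql (I : Type) (D : set I) (f f' g : I -> R) :
  (forall i, D i -> f i = f' i) -> asymp D f' g -> asymp D f g.
Proof. by move=> ff' [C C0 fg]; exists C => // i Di; rewrite ff'//; exact: fg. Qed.

Lemma asymp_eqr (I : Type) (D : set I) (f g g' : I -> R) :
  (forall i, D i -> g i = g' i) -> asymp D f g' -> asymp D f g.
Proof. by move=> gg' [C C0 fg]; exists C => // i Di; rewrite gg'//; exact: fg. Qed.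

Lemma asymp_trans (I : Type) (D : set I) (f g h : I -> R) :
  asymp D f g -> asymp D g h -> asymp D f h.
Proof.
move=> [C C0 fg] [K K0 gh]; exists (C * K); first exact: mulr_gt0.
move=> i Di; have [_ /andP[lo up]] := fg i Di.
have [h0 /andP[lo' up']] := gh i Di; split=> //; apply/andP; split.
  by apply: le_trans lo; rewrite invfM -mulrA ler_wpM2l// invr_ge0 ltW.
by apply: (le_trans up); rewrite -mulrA ler_wpM2l// ltW.
Qed.

Lemma asympM (I : Type) (D : set I) (f f' g g' : I -> R) :
  asymp D f g -> asymp D f' g' ->
  asymp D (fun i => f i * f' i) (fun i => g i * g' i).
Proof.
move=> fg fg'; have f0 := asymp_pos fg; have f0' := asymp_pos fg'.
move: fg fg' => [C C0 fg] [K K0 fg']; exists (C * K); first exact: mulr_gt0.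
move=> i Di; have [g0 /andP[lo up]] := fg i Di.
have [g0' /andP[lo' up']] := fg' i Di; split; first exact: mulr_gt0.
rewrite invfM mulrACA [in X in _ && X]mulrACA; apply/andP; split.
  by apply: ler_pM => //; rewrite mulr_ge0// ?invr_ge0 ltW.
by apply: ler_pM => //; apply/ltW; [exact: f0|exact: f0'].
Qed.

Lemma asympV (I : Type) (D : set I) (f g : I -> R) :
  asymp D f g -> asymp D (fun i => (f i)^-1) (fun i => (g i)^-1).
Proof.
move=> fg; have f0 := asymp_pos fg.
case: fg => C C0 fg; exists C => // i Di; have [g0 /andP[lo up]] := fg i Di.
have fi0 := f0 _ Di.
split; first by rewrite invr_gt0.
rewrite -invfM lef_pV2 ?posrE ?mulr_gt0// up/= -[C]invrK -invfM.
by rewrite lef_pV2 ?posrE ?mulr_gt0 ?invr_gt0.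
Qed.

(** A negative exponent is reduced to a positive one by taking inverses; for a
    nonnegative exponent the constant C becomes its power. *)
Lemma asymp_powR (I : Type) (D : set I) (f g : I -> R) (p : R) :
  asymp D f g -> asymp D (fun i => f i `^ p) (fun i => g i `^ p).
Proof.
wlog p0 : p f g / 0 <= p => [wl|] fg.
  have [/wl|/ltW p0] := leP 0 p; first exact.
  have := asympV (wl (- p) _ _ _ fg); rewrite oppr_ge0 => /(_ p0) h.
  have E (h' : I -> R) : (fun i => h' i `^ p) = (fun i => (h' i `^ (- p))^-1).
    by apply/funext => i; rewrite -powRN opprK.
  by rewrite !E.
have f0 := asymp_pos fg; case: fg => C C0 fg.
exists (C `^ p); first exact: powR_gt0.
move=> i Di; have [g0 /andP[lo up]] := fg i Di; split; first exact: powR_gt0.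
have fi0 := f0 _ Di.
have Cp : (C^-1) `^ p = (C `^ p)^-1 by rewrite -(powR_inv1 (ltW C0)) powRAC powR_inv1 ?powR_ge0.
rewrite -Cp -!powRM ?invr_ge0; try exact: ltW.
apply/andP; split; apply: ge0_ler_powR; rewrite ?nnegrE//.
- by rewrite mulr_ge0// ?invr_ge0 ltW.
- exact: ltW.
- exact: ltW.
- by rewrite mulr_ge0// ltW.
Qed.

Lemma asymp_prod (I : Type) (D : set I) (n : nat) (f g : 'I_n -> I -> R) :
  (forall j, asymp D (f j) (g j)) ->
  asymp D (fun i => \prod_(j < n) f j i) (fun i => \prod_(j < n) g j i).
Proof.
elim: n f g => [|n IH] f g fg.
  by apply: asymp_refl => i _; rewrite !big_ord0.
have E (h : 'I_n.+1 -> I -> R) : (fun i => \prod_(j < n.+1) h j i) =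
    (fun i => h ord0 i * \prod_(j < n) h (lift ord0 j) i).
  by apply/funext => i; rewrite big_ord_recl.
by rewrite !E; apply: asympM => //; apply: IH => j.
Qed.

Lemma asympZ (I : Type) (D : set I) (f g : I -> R) (c : R) : 0 < c ->
  asymp D f g -> asymp D (fun i => c * f i) g.
Proof.
move=> c0 [C C0 fg].
apply: (@asymp_bounds _ _ _ _ (c * C^-1) (c * C)); rewrite ?mulr_gt0 ?invr_gt0//.
- by move=> i /fg[].
- by move=> i /fg[_ /andP[lo _]]; rewrite -mulrA ler_pM2l.
- by move=> i /fg[_ /andP[_ up]]; rewrite -mulrA ler_pM2l.
Qed.

(** Estimates in auxiliary parameters, such as x^2/(2t), are transported to
    estimates in the original ones. *)
Lemma asymp_comp (I J : Type) (D : set I) (E : set J) (phi : J -> I)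
    (f g : I -> R) : (forall j, E j -> D (phi j)) ->
  asymp D f g -> asymp E (f \o phi) (g \o phi).
Proof. by move=> ED [C C0 fg]; exists C => // j /ED; exact: fg. Qed.

End asymp.

(** * Affine changes of variable *)

Section change_of_variable.
Context {R : realType}.
Local Notation mu := (@lebesgue_measure R).
Local Notation rT := (measurableTypeR R).
Local Open Scope ereal_scope.

Lemma ge0_integral_opp (D : set R) (f : R -> \bar R) : measurable D ->
  measurable_fun D f -> (forall x, D x -> 0 <= f x) ->
  \int[mu]_(x in D) f x = \int[mu]_(x in -%R @^-1` D) f (- x)%R.
Proof.
move=> mD mf f0.
rewrite -(@ge0_integral_pushforward _ _ rT rT _ -%R _ mu D f)//; last first.
  by move=> x /[!inE]; exact: f0.
by apply: eq_measure_integral => A mA _; exact/esym/lebesgue_measureN.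
Qed.

Lemma lebesgue_measure_shift (c : R) (A : set R) : measurable A ->
  pushforward mu (+%R c : rT -> rT) A = mu A.
Proof.
move=> mA; have mc : measurable_fun setT (+%R c : rT -> rT).
  exact: measurable_funD.
pose nu := pushforward mu (+%R c : rT -> rT).
apply/esym; rewrite -[RHS]/(nu A).
apply: lebesgue_measure_unique => //= _ [[a b]] _ <-; rewrite /nu /pushforward.
rewrite (_ : _ @^-1` _ = `](a - c)%R, (b - c)%R]%classic); last first.
  by apply/seteqP; split => x /=; rewrite !in_itv/= ltrBlDl lerBrDl.
rewrite !lebesgue_measure_itv/= !lte_fin ltrD2r.
by case: ifP => // _; rewrite -!EFinB; congr EFin; ring.
Qed.

Lemma ge0_integral_shift (c : R) (D : set R) (f : R -> \bar R) :
  measurable D -> measurable_fun D f -> (forall x, D x -> 0 <= f x) ->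
  \int[mu]_(x in D) f x = \int[mu]_(x in +%R c @^-1` D) f (c + x)%R.
Proof.
move=> mD mf f0.
have mc : measurable_fun setT (+%R c : rT -> rT) by exact: measurable_funD.
rewrite -(ge0_integral_pushforward mc mu)//; last by move=> x /[!inE]; exact: f0.
apply: eq_measure_integral => A mA _.
exact/esym/lebesgue_measure_shift.
Qed.

End change_of_variable.

(** * Elementary bounds on real powers *)

Section powR_bounds.
Context {R : realType}.

(** Write x^p = (p/c)^p (cx/p)^p and use y <= exp y at y = cx/p. *)
Lemma powR_le_expR (p c x : R) : 0 < p -> 0 < c -> 0 <= x ->
  x `^ p <= (p / c) `^ p * expR (c * x).
Proof.
move=> p0 c0 x0.
have -> : x `^ p = (p / c) `^ p * (c * x / p) `^ p.
  rewrite -powRM; first by congr powR; field; rewrite !gt_eqF.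
    by rewrite divr_ge0// ltW.
  by rewrite divr_ge0 ?mulr_ge0 ?(ltW c0) ?(ltW p0).
rewrite ler_wpM2l ?powR_ge0//.
have -> : c * x = p * (c * x / p) by field; rewrite gt_eqF.
rewrite [in leRHS]mulrC expRM.
set y := (c * x / p); have y0 : 0 <= y.
  by rewrite divr_ge0 ?mulr_ge0 ?(ltW c0) ?(ltW p0).
have -> : p * y / p = y by field; rewrite gt_eqF.
apply: ge0_ler_powR; rewrite ?nnegrE ?expR_ge0//; first exact: ltW.
by apply: le_trans (expR_ge1Dx y); rewrite lerDr.
Qed.

(** Exponents of either sign occur below, so the bounds are in terms of |p|: for
    p < 0 replace s by its inverse, which lies in the same interval. *)
Lemma powR_near1 (p s : R) : 2^-1 <= s -> s <= 2 ->
  2 `^ (- `|p|) <= s `^ p <= 2 `^ `|p|.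
Proof.
move=> s1 s2; have s0 : 0 < s by apply: lt_le_trans s1; rewrite invr_gt0.
have [e [es ep]] : exists e, s `^ p = e `^ `|p| /\ 2^-1 <= e <= 2.
  have [p0|p0] := leP 0 p; first by exists s; rewrite ger0_norm// s1 s2.
  exists s^-1; split.
    by rewrite -(powR_inv1 (ltW s0)) -powRrM ltr0_norm// mulrNN mul1r.
  rewrite lef_pV2 ?posrE// s2/= -[leRHS]invrK lef_pV2 ?posrE//.
rewrite es powRN; case/andP: ep => e1 e2.
have e0 : 0 < e by apply: lt_le_trans e1; rewrite invr_gt0.
apply/andP; split; last by apply: ge0_ler_powR; rewrite ?nnegrE// ltW.
rewrite -powR_inv1 ?powR_ge0// powRAC powR_inv1//.
by apply: ge0_ler_powR; rewrite ?nnegrE// ltW.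
Qed.

End powR_bounds.

(** * Gamma integrals *)

Section gamma.
Context {R : realType}.
Local Notation mu := (@lebesgue_measure R).

Lemma measurable_EFin_powR (p : R) (D : set R) :
  measurable_fun D (fun v : R => (v `^ p)%:E).
Proof.
by apply/measurable_EFinP; apply: measurable_funTS; exact: measurable_powR.
Qed.

Lemma measurable_powRexp (p w : R) (D : set R) :
  measurable_fun D (fun v : R => v `^ p * expR (- (w * v))).
Proof.
apply: measurable_funTS.
apply: measurable_funM; first exact: measurable_powR.
by apply: measurableT_comp => //; apply: measurableT_comp.
Qed.

(** For a < 1 the integrand is unbounded at 0: the antiderivative x^a/a is used on
    [d/(n+2), d], and n tends to infinity by monotone convergence. *)
Lemma integral_powR_le (a d : R) : 0 < a -> 0 < d ->
  (\int[mu]_(x in `]0%R, d]) (x `^ (a - 1))%:E <= (d `^ a / a)%:E)%E.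
Proof.
move=> a0 d0.
pose F n : set R := `[(d / n.+2%:R)%R, d]%classic.
have FE : `]0%R, d]%classic = \bigcup_n F n.
  apply/seteqP; split => [x|x [n _]] /=; rewrite /F/= !in_itv/= => /andP[x0 xd].
    have [n] := ltr_add_invr (divr_gt0 x0 d0).
    rewrite add0r ltr_pdivlMr// mulrC => nx.
    exists n => //=; rewrite in_itv/= xd andbT; apply/ltW/(le_lt_trans _ nx).
    by rewrite ler_pM2l// lef_pV2 ?posrE// ler_nat.
  by rewrite xd andbT; apply: lt_le_trans x0; exact: divr_gt0.
have cF : (\int[mu]_(x in F i) (x `^ (a - 1))%:E @[i --> \oo] -->
    \int[mu]_(x in `]0%R, d]) (x `^ (a - 1))%:E)%E.
  rewrite FE; apply: ge0_nondecreasing_set_cvg_integral => //.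
  - apply/nondecreasing_seqP => n; rewrite subsetEset => x.
    rewrite /F/= !in_itv/= => /andP[h ->]; rewrite andbT; apply: le_trans h.
    by rewrite ler_pM2l// lef_pV2 ?posrE// ler_nat.
  - by move=> n; exact: measurable_itv.
  - by move=> n; exact: measurable_EFin_powR.
  - by move=> n x _; rewrite lee_fin powR_ge0.
rewrite -(cvg_lim _ cF)//; apply: lime_le; first exact: (cvgP _ cF).
apply: nearW => n; rewrite /F.
set e := d / n.+2%:R; have e0 : 0 < e by exact: divr_gt0.
have ed : e < d by rewrite ltr_pdivrMr// ltr_pMr// ltr1n.
have dpow (p x : R) : e <= x -> derivable (fun y : R => y `^ p) x 1.
  by move=> ex; apply: derivable_powR; rewrite in_itv/= (lt_le_trans e0 ex).
have dF (x : R) : e <= x -> derivable (fun x : R => a^-1 * x `^ a) x 1.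
  by move=> ex; apply: derivableM => //; exact: dpow.
have cdF (x : R) : e <= x -> {for x, continuous (fun x : R => a^-1 * x `^ a)}.
  by move=> ex; apply/differentiable_continuous/derivable1_diffP/dF.
rewrite (@continuous_FTC2 _ _ (fun x => a^-1 * x `^ a))//.
- rewrite -EFinB lee_fin mulrC lerBlDr lerDl mulr_ge0 ?powR_ge0//.
  by rewrite invr_ge0 ltW.
- apply: derivable_within_continuous => x; rewrite in_itv/= => /andP[ex _].
  exact: dpow.
- split.
  + by move=> x; rewrite in_itv/= => /andP[ex _]; exact/dF/ltW.
  + exact/cvg_at_right_filter/cdF.
  + exact/cvg_at_left_filter/cdF/ltW.
- move=> x; rewrite in_itv/= => /andP[/ltW ex _].
  rewrite derive1Ml; last exact: dpow.
  rewrite powR_derive1 ?in_itv/= ?(lt_le_trans e0 ex)//.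
  by rewrite mulKf ?gt_eqF.
Qed.

(** Split at 1/w. Below, the exponential is at most 1. Above, w v >= 1, so that
    (wv)^(a-1) <= (wv)^a is absorbed by half of the exponential, leaving a
    multiple of the exponential density of rate w/2. *)
Lemma integral_powRexp_le (a : R) : 0 < a -> exists2 C, 0 < C &
  forall w : R, 0 < w ->
  (\int[mu]_(v in `]0%R, +oo[) (v `^ (a - 1) * expR (- (w * v)))%:E <=
   (C * w `^ (- a))%:E)%E.
Proof.
move=> a0; set K := (a / 2^-1) `^ a; have K0 : 0 < K.
  by rewrite powR_gt0// divr_gt0// invr_gt0.
exists (a^-1 + 2 * K) => [|w w0]; first by rewrite addr_gt0 ?mulr_gt0 ?invr_gt0.
have wV0 : 0 < w^-1 by rewrite invr_gt0.
have f0 (v : R) : (0 <= (v `^ (a - 1) * expR (- (w * v)))%:E)%E.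
  by rewrite lee_fin mulr_ge0 ?powR_ge0 ?expR_ge0.
have mf D : measurable_fun D (fun v : R => (v `^ (a - 1) * expR (- (w * v)))%:E).
  by apply/measurable_EFinP; exact: measurable_powRexp.
rewrite (@itv_bndbnd_setU _ _ _ (BRight w^-1)) ?bnd_simp//; last exact: ltW.
rewrite ge0_integral_setU//=; last 2 first.
- exact: mf.
- rewrite disj_set2E; apply/eqP/seteqP; split => // x [] /=; rewrite !in_itv/=.
  by move=> /andP[_ /le_lt_trans h]; rewrite andbT => /h; rewrite ltxx.
rewrite mulrDl EFinD; apply: leeD.
  apply: (@le_trans _ _ (\int[mu]_(x in `]0%R, w^-1%R]) (x `^ (a - 1))%:E)%E).
    apply: ge0_le_integral => //=.
      exact: mf.
      exact: measurable_EFin_powR.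
    move=> v; rewrite in_itv/= => /andP[v0 _]; rewrite lee_fin ler_piMr ?powR_ge0//.
    by rewrite -expR0 ler_expR oppr_le0 mulr_ge0 ?(ltW w0) ?(ltW v0).
  apply: (le_trans (integral_powR_le _ _)) => //.
  by rewrite lee_fin -(powR_inv1 (ltW w0)) -powRrM mulN1r mulrC.
have w20 : 0 < w / 2 by rewrite divr_gt0.
pose g (v : R) := (2 * K * w `^ (- a) * exponential_pdf (w / 2) v)%:E.
have g0 (v : R) : (0 <= (exponential_pdf (w / 2) v)%:E)%E.
  by rewrite lee_fin exponential_pdf_ge0// ltW.
have c0 : 0 <= 2 * K * w `^ (- a) by rewrite !mulr_ge0 ?powR_ge0// ltW.
have mpdf D : measurable_fun D (fun v => (exponential_pdf (w / 2) v)%:E).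
  apply/measurable_EFinP.
  apply: measurable_funTS.
  exact: measurable_exponential_pdf.
have mg D : measurable_fun D g.
  by apply/measurable_EFinP; apply: measurable_funM => //; exact/measurable_EFinP.
apply: (@le_trans _ _ (\int[mu]_(v in `]w^-1%R, +oo[) g v)%E).
  apply: ge0_le_integral => //=.
    exact: mf.
    exact: mg.
  move=> v; rewrite in_itv/= andbT => wv; have v0 := lt_trans wV0 wv.
  rewrite lee_fin exponential_pdfE; last exact: ltW.
  have wv1 : 1 <= w * v by rewrite mulrC -ler_pdivrMr// div1r ltW.
  have -> : v `^ (a - 1) = w * w `^ (- a) * (w * v) `^ (a - 1).
    rewrite powRM ?ltW// !mulrA -(mulrA w) -powRD; last by rewrite (gt_eqF w0) implybT.
    by rewrite (_ : - a + (a - 1) = - 1) ?powR_inv1 ?mulfV ?mul1r ?gt_eqF ?ltW//; ring.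
  have h1 : (w * v) `^ (a - 1) <= (w * v) `^ a.
    by apply: ler_powR => //; rewrite gerBl.
  have wv0 : 0 <= w * v by exact: le_trans wv1.
  have h20 : 0 < 2^-1 :> R by [].
  have := le_trans h1 (powR_le_expR a0 h20 wv0); rewrite -/K => h2.
  rewrite (_ : 2 * K * w `^ (- a) * (w / 2 * expR (- (w / 2) * v)) =
    w * w `^ (- a) * (K * expR (2^-1 * (w * v)) * expR (- (w * v)))); last first.
    rewrite -(mulrA K) -expRD.
    rewrite (_ : 2^-1 * (w * v) + - (w * v) = - (w / 2) * v); last by field.
    by field.
  rewrite -mulrA ler_wpM2l ?mulr_ge0 ?powR_ge0 ?(ltW w0)//.
  by rewrite ler_wpM2r// expR_ge0.
rewrite /g; under eq_integral do rewrite EFinM.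
rewrite ge0_integralZl_EFin//=; last exact: mpdf.
rewrite -[leRHS]mule1; apply: lee_wpmul2l; first by rewrite lee_fin.
rewrite -(integral_exponential_pdf w20).
by apply: ge0_subset_integral => //; exact: mpdf.
Qed.

End gamma.

(** * Integrals bounded by constants on sets *)

Section integral_bounds.
Context d (T : measurableType d) (R : realType) (mu : {measure set T -> \bar R}).
Local Open Scope ereal_scope.

Lemma integral_le_cst (D : set T) (f : T -> R) (M : R) : measurable D ->
  measurable_fun D (fun x => (f x)%:E) -> (forall x, D x -> (0 <= f x <= M)%R) ->
  \int[mu]_(x in D) (f x)%:E <= M%:E * mu D.
Proof.
move=> mD mf fM; rewrite -integral_cst//; apply: ge0_le_integral => //.
- by move=> x /fM /andP[f0 _]; rewrite lee_fin.
- by move=> x /fM /andP[_ fx]; rewrite lee_fin.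
Qed.

Lemma integral_ge_cst (D B : set T) (f : T -> R) (m : R) : measurable D ->
  measurable B -> B `<=` D -> measurable_fun D (fun x => (f x)%:E) ->
  (forall x, D x -> (0 <= f x)%R) -> (0 <= m)%R ->
  (forall x, B x -> (m <= f x)%R) ->
  m%:E * mu B <= \int[mu]_(x in D) (f x)%:E.
Proof.
move=> mD mB BD mf f0 m0 fm; rewrite -integral_cst//.
apply: (@le_trans _ _ (\int[mu]_(x in B) (f x)%:E)).
  by apply: ge0_le_integral => //; exact: (measurable_funS mD BD mf).
by apply: ge0_subset_integral => // x /f0; rewrite lee_fin.
Qed.

(** Two-sided bounds by reals also exclude infinite values, at which fine is 0. *)
Lemma fine_bounds (x : \bar R) (m M : R) : m%:E <= x -> x <= M%:E ->
  (m <= fine x <= M)%R.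
Proof. by case: x => [r| |]//=; rewrite !lee_fin => -> ->. Qed.

End integral_bounds.

(** * Positivity of Gamma and integrals over [-1,1] *)

Section gamma_beta.
Context {R : realType}.
Local Notation mu := (@lebesgue_measure R).

(** Finiteness of the integral matters as much as its positivity, since gamma_fun
    would be 0 if it diverged. *)
Lemma gamma_fun_gt0 (a : R) : 0 < a -> 0 < gamma_fun a.
Proof.
move=> a0; have [C C0 /(_ 1 ltr01) up] := integral_powRexp_le a0.
rewrite /gamma_fun.
have lo : ((2 `^ (- `|a - 1|) * expR (-2))%:E * mu `[1%R, 2%R] <=
    \int[mu]_(v in `]0%R, +oo[) (v `^ (a - 1) * expR (- (1 * v)))%:E)%E.
  apply: integral_ge_cst => //.
  - move=> x /=; rewrite !in_itv/= andbT => /andP[x1 _].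
    by apply: lt_le_trans x1.
  - by apply/measurable_EFinP; exact: measurable_powRexp.
  - by move=> x _; rewrite mulr_ge0 ?powR_ge0 ?expR_ge0.
  - move=> x /=; rewrite in_itv/= => /andP[x1 x2].
    apply: ler_pM; rewrite ?powR_ge0 ?expR_ge0//.
      have x12 : 2^-1 <= x by lra.
      by case/andP: (powR_near1 (a - 1) x12 x2).
    by rewrite ler_expR; lra.
rewrite lebesgue_measure_itv/= lte_fin ltr1n/= -EFinB -EFinM in lo.
have := fine_bounds lo up; under eq_integral do rewrite mul1r.
case/andP => + _; apply: lt_le_trans.
rewrite !mulr_gt0 ?powR_gt0 ?expR_gt0//; lra.
Qed.

Lemma integral_reflect (f : R -> R) : measurable_fun setT f ->
  (forall x, 0 <= f x) ->
  (\int[mu]_(u in `[(-1)%R, 1%R]) (f u)%:E =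
   \int[mu]_(u in `[(-1)%R, 1%R]) (f (- u))%:E)%E.
Proof.
move=> mf f0; rewrite ge0_integral_opp//=; first last.
- by move=> x _; rewrite lee_fin.
- by apply/measurable_EFinP; exact: measurable_funTS.
congr integral; apply/seteqP; split => x /=; rewrite !in_itv/= => /andP[? ?].
  by apply/andP; split; lra.
by apply/andP; split; lra.
Qed.

Lemma integral_shift1_le (f : R -> R) : measurable_fun setT f ->
  (forall x, 0 <= f x) ->
  (\int[mu]_(u in `[(-1)%R, 1%R]) (f (1 + u))%:E <=
   \int[mu]_(v in `]0%R, +oo[) (f v)%:E)%E.
Proof.
move=> mf f0; have mfD (D : set R) : measurable_fun D (fun x => (f x)%:E).
  by apply/measurable_EFinP; exact: measurable_funTS.
rewrite integral_itv_obnd_cbnd; last exact: mfD.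
rewrite [leRHS](ge0_integral_shift 1)//; last by move=> x _; rewrite lee_fin.
have m1 : measurable_fun setT (+%R (1 : R)) by exact: measurable_funD.
apply: ge0_subset_integral => //.
- by rewrite -[X in measurable X]setTI; exact: m1.
- apply/measurable_EFinP; apply: measurable_funTS.
  exact: (measurableT_comp mf).
- by move=> x _; rewrite lee_fin.
- by move=> x /=; rewrite !in_itv/= => /andP[? ?]; rewrite andbT; lra.
Qed.

Lemma integral_shift1N_le (f : R -> R) : measurable_fun setT f ->
  (forall x, 0 <= f x) ->
  (\int[mu]_(u in `[(-1)%R, 1%R]) (f (1 - u))%:E <=
   \int[mu]_(v in `]0%R, +oo[) (f v)%:E)%E.
Proof.
move=> mf f0.
rewrite -(@integral_reflect (fun u => f (1 + u)))//; first exact: integral_shift1_le.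
by apply: (measurableT_comp mf); exact: measurable_funD.
Qed.

End gamma_beta.

(** * The Laplace-type integral with Jacobi weight *)

Definition jacobi_exp {R : realType} (p q z u : R) : R :=
  (1 - u) `^ p * (1 + u) `^ q * expR (- (z * (1 - u))).

Section jacobi_laplace.
Context {R : realType}.
Local Notation mu := (@lebesgue_measure R).
Variables (p q : R).
Hypotheses (p_gt : -1 < p) (q_gt : -1 < q).

Local Notation jl := (jacobi_exp p q).

Let jl_ge0 z u : 0 <= jl z u.
Proof. by rewrite /jacobi_exp !mulr_ge0 ?powR_ge0 ?expR_ge0. Qed.

Let measurable_jl z (D : set R) : measurable_fun D (fun u => (jl z u)%:E).
Proof.
apply/measurable_EFinP; apply: measurable_funTS.
have m1N : measurable_fun setT (fun u : R => 1 - u) by exact: measurable_funB.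
apply: measurable_funM.
  apply: measurable_funM.
    by apply: (measurableT_comp (measurable_powR _)).
  by apply: (measurableT_comp (measurable_powR _)); exact: measurable_funD.
apply: measurableT_comp => //; apply: measurableT_comp => //.
exact: measurable_funM.
Qed.

(** With w = 1+z, restrict to 1/(2w) <= 1-u <= 1/w: there (1-u)^p is comparable
    to w^(-p), the other two factors are bounded below, and the length is 1/(2w). *)
Lemma jacobi_laplace_ge : exists2 c, 0 < c & forall z, 0 <= z ->
  ((c * (1 + z) `^ (- (p + 1)))%:E <=
   \int[mu]_(u in `[(-1)%R, 1%R]) (jl z u)%:E)%E.
Proof.
set A := 2 `^ (- `|p|); set B := 2 `^ (- `|q|).
have A0 : 0 < A by exact: powR_gt0.
have B0 : 0 < B by exact: powR_gt0.
exists (A * B * expR (-1) / 2) => [|z z0].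
  by rewrite !mulr_gt0 ?expR_gt0 ?invr_gt0.
set w := 1 + z; have w1 : 1 <= w by rewrite lerDl.
have w0 : 0 < w by exact: lt_le_trans w1.
have wV0 : 0 < w^-1 by rewrite invr_gt0.
have wV1 : w^-1 <= 1 by rewrite invf_le1.
pose m := w `^ (- p) * A * B * expR (-1).
pose I : set R := `[(1 - w^-1)%R, (1 - w^-1 / 2)%R]%classic.
have -> : ((A * B * expR (-1) / 2 * w `^ (- (p + 1)))%:E = m%:E * mu I)%E.
  rewrite lebesgue_measure_itv/= lte_fin.
  rewrite ifT; last by lra.
  rewrite -EFinB -EFinM; congr EFin; rewrite /m.
  rewrite (_ : - (p + 1) = - p - 1); last by ring.
  rewrite powRD; last by rewrite (gt_eqF w0) implybT.
  by rewrite powR_inv1 ?(ltW w0)//; field; rewrite gt_eqF.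
apply: integral_ge_cst => //.
- exact: measurable_itv.
- by move=> u; rewrite /I /= !in_itv/= => /andP[? ?]; apply/andP; split; lra.
- exact: measurable_jl.
- by rewrite /m !mulr_ge0 ?powR_ge0 ?expR_ge0.
move=> u; rewrite /I/= in_itv/= => /andP[u1 u2].
set v := 1 - u; have v1 : v <= w^-1 by rewrite /v; lra.
have v2 : w^-1 / 2 <= v by rewrite /v; lra.
have v0 : 0 < v by apply: lt_le_trans v2; rewrite divr_gt0.
have wv1 : w * v <= 1 by rewrite mulrC -ler_pdivlMr// div1r.
have wv2 : 2^-1 <= w * v by rewrite mulrC -ler_pdivrMr// mulrC.
have -> : m = w `^ (- p) * (A * B * expR (-1)) by rewrite /m !mulrA.
have -> : jl z u = w `^ (- p) * ((w * v) `^ p * (1 + u) `^ q * expR (- (z * v))).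
  rewrite powRM ?(ltW w0) ?(ltW v0)// !mulrA -powRD; last by rewrite (gt_eqF w0) implybT.
  by rewrite addNr powRr0 mul1r.
rewrite ler_wpM2l ?powR_ge0//; apply: ler_pM; rewrite ?mulr_ge0 ?expR_ge0 ?(ltW A0) ?(ltW B0)//.
  apply: ler_pM; rewrite ?(ltW A0) ?(ltW B0)//.
    have wv3 : w * v <= 2 by lra.
    by case/andP: (powR_near1 p wv2 wv3).
  have [u3 u4] : 2^-1 <= 1 + u /\ 1 + u <= 2 by split; lra.
  by case/andP: (powR_near1 q u3 u4).
rewrite ler_expR lerN2; apply: le_trans wv1.
by rewrite ler_wpM2r ?(ltW v0)// /w lerDr.
Qed.

(** With w = 1+z, the part u >= 0 is bounded by the Gamma integral in 1-u with
    rate w. For u < 0 the exponential is at most exp(-z), which beats any power of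
    w, while (1+u)^q has a finite integral because q > -1. *)
Lemma jacobi_laplace_le : exists2 C, 0 < C & forall z, 0 <= z ->
  (\int[mu]_(u in `[(-1)%R, 1%R]) (jl z u)%:E <=
   (C * (1 + z) `^ (- (p + 1)))%:E)%E.
Proof.
have p10 : 0 < p + 1 by rewrite addrC -ltrBlDl sub0r.
have q10 : 0 < q + 1 by rewrite addrC -ltrBlDl sub0r.
have [Cp Cp0 hp] := integral_powRexp_le p10; rewrite addrK in hp.
have [Cq Cq0 hq] := integral_powRexp_le q10; rewrite addrK in hq.
set A := 2 `^ `|p|; set B := 2 `^ `|q|; set e := expR 1 : R.
have A1 : 1 <= A by rewrite -(powRr0 2); apply: ler_powR => //; rewrite ler1n.
have B1 : 1 <= B by rewrite -(powRr0 2); apply: ler_powR => //; rewrite ler1n.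
have e1 : 1 <= e by rewrite -expR0 ler_expR.
have A0 : 0 < A by exact: lt_le_trans A1.
have B0 : 0 < B by exact: lt_le_trans B1.
have e0 : 0 < e by exact: lt_le_trans e1.
pose K := A * B * (e * e); have K0 : 0 < K by rewrite !mulr_gt0.
pose L := ((p + 1) / 1) `^ (p + 1); have L0 : 0 < L by rewrite powR_gt0 ?divr_gt0.
exists (K * (Cp + L * Cq)) => [|z z0].
  by rewrite mulr_gt0// addr_gt0// mulr_gt0.
set w := 1 + z; have w1 : 1 <= w by rewrite lerDl.
have w0 : 0 < w by exact: lt_le_trans w1.
pose G (r y v : R) := v `^ r * expR (- (y * v)).
have G0 r y v : 0 <= G r y v by rewrite mulr_ge0 ?powR_ge0 ?expR_ge0.
have mG r y (D : set R) : measurable_fun D (G r y) by exact: measurable_powRexp.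
have mG1 (D : set R) : measurable_fun D (fun u : R => (G p w (1 - u))%:E).
  apply/measurable_EFinP; apply: measurable_funTS.
  by apply: (measurableT_comp (mG _ _ _)); exact: measurable_funB.
have mG2 (D : set R) : measurable_fun D (fun u : R => (G q 1 (1 + u))%:E).
  apply/measurable_EFinP; apply: measurable_funTS.
  by apply: (measurableT_comp (mG _ _ _)); exact: measurable_funD.
(* e^2 absorbs the replacement of z by w = 1+z in the exponentials and, for
   u < 0, the factor exp(-(1+u)) of the second term. *)
have pw u : -1 <= u -> u <= 1 ->
    jl z u <= K * G p w (1 - u) + K * expR (- w) * G q 1 (1 + u).
  move=> u1 u2; have [u0|u0] := leP 0 u.
    apply: (@le_trans _ _ (K * G p w (1 - u))); last first.
      by rewrite lerDl !mulr_ge0 ?expR_ge0 ?powR_ge0// ltW.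
    have -> : jl z u = (1 + u) `^ q * expR (1 - u) * G p w (1 - u).
      have E : expR (- (z * (1 - u))) = expR (1 - u) * expR (- (w * (1 - u))).
        by rewrite -expRD; congr expR; rewrite /w; ring.
      by rewrite /jacobi_exp /G E; ring.
    apply: ler_wpM2r; first exact: G0.
    have qB : (1 + u) `^ q <= B.
      have [u3 u4] : 2^-1 <= 1 + u /\ 1 + u <= 2 by split; lra.
      by case/andP: (powR_near1 q u3 u4).
    have ee : expR (1 - u) <= e by rewrite ler_expR; lra.
    apply: (@le_trans _ _ (B * e)); first by apply: ler_pM; rewrite ?powR_ge0 ?expR_ge0.
    have -> : K = B * e * (A * e) by rewrite /K; ring.
    by rewrite ler_peMr ?mulr_ege1// mulr_ge0 ?(ltW B0) ?(ltW e0).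
  apply: (@le_trans _ _ (K * expR (- w) * G q 1 (1 + u))); last first.
    by rewrite lerDr !mulr_ge0 ?expR_ge0 ?powR_ge0// ltW.
  have pA : (1 - u) `^ p <= A.
    have [u3 u4] : 2^-1 <= 1 - u /\ 1 - u <= 2 by split; lra.
    by case/andP: (powR_near1 p u3 u4).
  have zw : expR (- (z * (1 - u))) <= e * expR (- w).
    rewrite -expRD ler_expR /w (_ : 1 - (1 + z) = - z); last by ring.
    by rewrite lerN2 ler_peMr//; lra.
  have qG : (1 + u) `^ q <= e * G q 1 (1 + u).
    have {1}-> : (1 + u) `^ q = expR (1 + u) * G q 1 (1 + u).
      by rewrite /G mulrCA -expRD mul1r subrr expR0 mulr1.
    by rewrite ler_wpM2r// ler_expR; lra.
  apply: (@le_trans _ _ (A * (e * G q 1 (1 + u)) * (e * expR (- w)))).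
    apply: ler_pM; rewrite ?mulr_ge0 ?powR_ge0 ?expR_ge0//.
    by apply: ler_pM; rewrite ?powR_ge0.
  have -> : A * (e * G q 1 (1 + u)) * (e * expR (- w)) =
      A * (e * e) * (expR (- w) * G q 1 (1 + u)) by ring.
  rewrite -(mulrA K); apply: ler_wpM2r; first by rewrite mulr_ge0 ?expR_ge0.
  have -> : K = A * (e * e) * B by rewrite /K; ring.
  by rewrite ler_peMr// !mulr_ge0 ?(ltW A0) ?(ltW e0).
apply: (@le_trans _ _ (\int[mu]_(u in `[(-1)%R, 1%R])
  (K%:E * (G p w (1 - u))%:E + (K * expR (- w))%:E * (G q 1 (1 + u))%:E))%E).
  apply: ge0_le_integral => //.
  - by move=> u _; rewrite lee_fin.
  - exact: measurable_jl.
  - apply: emeasurable_funD; apply: measurable_funeM; [exact: mG1|exact: mG2].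
  - by move=> u /=; rewrite in_itv/= => /andP[u1 u2]; rewrite -!EFinM -EFinD lee_fin pw.
have Kw0 : 0 <= K * expR (- w) by rewrite mulr_ge0 ?expR_ge0// ltW.
rewrite ge0_integralD//; first last.
- apply: measurable_funeM; exact: mG2.
- by move=> u _; rewrite -EFinM lee_fin mulr_ge0.
- apply: measurable_funeM; exact: mG1.
- by move=> u _; rewrite -EFinM lee_fin mulr_ge0// ltW.
rewrite !ge0_integralZl_EFin//; first last.
- exact: ltW.
- exact: mG1.
- by move=> u _; rewrite lee_fin.
- exact: mG2.
- by move=> u _; rewrite lee_fin.
have i1 := le_trans (integral_shift1N_le (mG p w _) (G0 p w)) (hp w w0).
have i2 := le_trans (integral_shift1_le (mG q 1 _) (G0 q 1)) (hq 1 ltr01).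
rewrite powR1 mulr1 in i2.
apply: (@le_trans _ _ (K%:E * (Cp * w `^ (- (p + 1)))%:E +
    (K * expR (- w))%:E * Cq%:E)%E).
  by apply: leeD; apply: lee_wpmul2l => //; rewrite lee_fin ?ltW.
rewrite -!EFinM -EFinD lee_fin (mulrDr K) mulrDl -(mulrA K Cp) lerD2l.
have wL : expR (- w) <= L * w `^ (- (p + 1)).
  rewrite expRN powRN ler_pdivlMr ?powR_gt0// mulrC ler_pdivrMr ?expR_gt0//.
  by rewrite -{2}(mul1r w); apply: powR_le_expR => //; exact: ltW.
rewrite (_ : K * (L * Cq) * _ = K * (L * w `^ (- (p + 1))) * Cq); last by ring.
by rewrite ler_wpM2r ?(ltW Cq0)// ler_wpM2l// ltW.
Qed.

Lemma jacobi_laplace_asymp :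
  asymp [set z | 0 <= z]
    (fun z => \int[mu]_(u in `[-1, 1]) jacobi_exp p q z u)
    (fun z => (1 + z) `^ (- (p + 1))).
Proof.
have [c c0 lo] := jacobi_laplace_ge; have [C C0 up] := jacobi_laplace_le.
have b z : 0 <= z -> _ := fun z0 => fine_bounds (lo z z0) (up z z0).
apply: (asymp_bounds c0 C0) => z /= z0.
- by rewrite powR_gt0// (lt_le_trans ltr01)// lerDl.
- by case/andP: (b z z0).
- by case/andP: (b z z0).
Qed.

End jacobi_laplace.

(** * The one-dimensional heat kernel *)

(** Domain of the estimates: pairs of a positive time and a point. *)
Definition pos_time {R : realType} (T : Type) : set (R * T) :=
  [set p | 0 < p.1].

(** Model of the measure of the ball of center p.2 and radius sqrt p.1. *)
Definition volume_model {R : realType} (k : R) (p : R * R) : R :=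
  Num.sqrt p.1 * (`|p.2| + Num.sqrt p.1) `^ (2 * k).

Definition kernel_integrand {R : realType} (k z u : R) : R :=
  (1 - u) `^ (k - 1) * (1 + u) `^ k * expR (z * u).

Section heat_kernel.
Context {R : realType}.
Local Notation mu := (@lebesgue_measure R).

(** An infinite integral gives 0 on both sides. *)
Lemma ge0_RintegralZl (D : set R) (f : R -> R) (c : R) : measurable D ->
  measurable_fun D f -> (forall x, D x -> 0 <= f x) -> 0 < c ->
  \int[mu]_(x in D) (c * f x) = c * \int[mu]_(x in D) f x.
Proof.
move=> mD mf f0 c0; rewrite /Rintegral.
under eq_integral do rewrite EFinM.
rewrite ge0_integralZl_EFin//; last 2 first.
- by apply/measurable_EFinP.
- exact: ltW.
have I0 : (0 <= \int[mu]_(x in D) (f x)%:E)%E.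
  by apply: integral_ge0 => x /f0; rewrite lee_fin.
case: (integral _ _ _) I0 => [r| |]//= _.
by rewrite gt0_muley ?lte_fin//= mulr0.
Qed.

Let measurable_kernel_integrand (k z : R) : measurable_fun setT (kernel_integrand k z).
Proof.
have m1N : measurable_fun setT (fun u : R => 1 - u) by exact: measurable_funB.
apply: measurable_funM.
  apply: measurable_funM.
    by apply: (measurableT_comp (measurable_powR _)).
  by apply: (measurableT_comp (measurable_powR _)); exact: measurable_funD.
by apply: measurableT_comp => //; exact: measurable_funM.
Qed.

Lemma dunkl_kernel_diag_integral (k z : R) :
  expR (- z) * \int[mu]_(u in `[-1, 1]) kernel_integrand k z u =
  \int[mu]_(u in `[-1, 1]) jacobi_exp (k - 1) k z u.
Proof.
rewrite -ge0_RintegralZl ?expR_gt0//.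
- apply: eq_Rintegral => u _; rewrite /kernel_integrand /jacobi_exp mulrCA -expRD.
  by congr (_ * expR _); ring.
- apply: measurable_funTS; exact: measurable_kernel_integrand.
- by move=> u _; rewrite !mulr_ge0 ?powR_ge0 ?expR_ge0.
Qed.

(** The reflection u -> -u exchanges the two exponents. *)
Lemma dunkl_kernel_antidiag_integral (k z : R) :
  expR (- z) * \int[mu]_(u in `[-1, 1]) kernel_integrand k (- z) u =
  \int[mu]_(u in `[-1, 1]) jacobi_exp k (k - 1) z u.
Proof.
have f0 u : 0 <= kernel_integrand k (- z) u.
  by rewrite !mulr_ge0 ?powR_ge0 ?expR_ge0.
rewrite {1}/Rintegral integral_reflect//.
rewrite -[X in _ * X]/(\int[mu]_(u in `[-1, 1]) kernel_integrand k (- z) (- u)).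
rewrite -ge0_RintegralZl ?expR_gt0//.
- apply: eq_Rintegral => u _; rewrite /kernel_integrand /jacobi_exp mulrCA -expRD opprK.
  by rewrite [_ `^ (k - 1) * _]mulrC; congr (_ * expR _); ring.
- apply: measurable_funTS; apply: measurableT_comp => //.
Qed.

Local Notation times := (@pos_time R R).

(** This is the 1 + z of the Laplace-type integral. *)
Let w (p : R * R) : R := 1 + p.2 ^+ 2 / (2 * p.1).

Let w_asymp_ball : asymp times w (fun p => (`|p.2| + Num.sqrt p.1) ^+ 2 / p.1).
Proof.
apply: (@asymp_bounds _ _ _ _ _ 4^-1 1) => // -[t x]; rewrite /pos_time/= => t0.
- by rewrite divr_gt0// exprn_gt0// ltr_wpDl// sqrtr_gt0.
- rewrite /w/=; have := sqr_sqrtr (ltW t0); set s := Num.sqrt t => ts.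
  have -> : 1 + x ^+ 2 / (2 * t) = (t + x ^+ 2 / 2) / t by field; rewrite gt_eqF.
  rewrite mulrA ler_pM2r ?invr_gt0// -ts -(real_normK (num_real x)).
  by have := sqr_ge0 (`|x| - s); lra.
- rewrite /w/=; have := sqr_sqrtr (ltW t0); set s := Num.sqrt t => ts.
  have -> : 1 + x ^+ 2 / (2 * t) = (t + x ^+ 2 / 2) / t by field; rewrite gt_eqF.
  rewrite mul1r ler_pM2r ?invr_gt0// -ts -(real_normK (num_real x)).
  have : 0 <= `|x| * s by rewrite mulr_ge0// sqrtr_ge0.
  by have := sqr_ge0 `|x|; lra.
Qed.

Let w_asymp_dist : asymp times w (fun p => (p.1 + p.2 ^+ 2) / p.1).
Proof.
apply: (@asymp_bounds _ _ _ _ _ 2^-1 1) => // -[t x]; rewrite /pos_time/= => t0.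
- by rewrite divr_gt0// ltr_wpDr// sqr_ge0.
- have -> : w (t, x) = (t + x ^+ 2 / 2) / t.
    by rewrite /w/=; field; rewrite gt_eqF.
  rewrite mulrA ler_pM2r ?invr_gt0//; lra.
- have -> : w (t, x) = (t + x ^+ 2 / 2) / t.
    by rewrite /w/=; field; rewrite gt_eqF.
  rewrite mul1r ler_pM2r ?invr_gt0//; have := sqr_ge0 x; lra.
Qed.

Let prefactor (k t : R) := t `^ (- k - 2^-1).

(** Here t w is comparable to (|x| + sqrt t)^2, so the powers of t collect into
    the inverse of the volume model. *)
Let prefactor_asymp (k : R) :
  asymp times (fun p => prefactor k p.1 * w p `^ (- k))
    (fun p => (volume_model k p)^-1).
Proof.
apply: (@asymp_trans _ _ _ _ (fun p => prefactor k p.1 *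
    ((`|p.2| + Num.sqrt p.1) ^+ 2 / p.1) `^ (- k))).
  apply: asympM; last exact: asymp_powR w_asymp_ball.
  by apply: asymp_refl => // -[t x] /= t0; exact: powR_gt0.
apply: asymp_refl => -[t x]; rewrite /pos_time/= => t0; rewrite /volume_model/=.
  by rewrite invr_gt0 mulr_gt0 ?sqrtr_gt0// powR_gt0// ltr_wpDl// sqrtr_gt0.
set b := _ + Num.sqrt t; have b0 : 0 < b by rewrite ltr_wpDl// sqrtr_gt0.
rewrite powRM ?invr_ge0 ?exprn_ge0 ?ltW// -powR_mulrn ?ltW// -powRrM.
rewrite -(powR_inv1 (ltW t0)) -powRrM mulrN mulrNN mul1r mulrCA.
rewrite /prefactor -powRD; last by rewrite (gt_eqF t0) implybT.
rewrite (_ : - k - 2^-1 + k = - 2^-1); last by ring.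
by rewrite !powRN powR12_sqrt ?ltW// -invfM mulrC.
Qed.

Let kernel_cst (k : R) : R :=
  (heat_cst k)^-1 * (gamma_fun (k + 2^-1) / (gamma_fun k * gamma_fun 2^-1)).

Let kernel_cst_gt0 k : 0 < k -> 0 < kernel_cst k.
Proof.
move=> k0; have k20 : 0 < k + 2^-1 by rewrite addr_gt0.
have h20 : 0 < 2^-1 :> R by [].
by rewrite /kernel_cst /heat_cst !(mulr_gt0, invr_gt0, powR_gt0, gamma_fun_gt0).
Qed.

(** The sign e = 1 or -1 treats the diagonal and the antidiagonal together: the
    Gaussian factor is the same. *)
Let heat_kernelE (k t x e : R) : 0 < t -> e = 1 \/ e = -1 ->
  heat_kernel1 k t x (e * x) = kernel_cst k * (prefactor k t *
    (expR (- (x ^+ 2 / (2 * t))) *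
     \int[mu]_(u in `[-1, 1]) kernel_integrand k (e * (x ^+ 2 / (2 * t))) u)).
Proof.
move=> t0 e1; rewrite /heat_kernel1 /dunkl_kernel1.
have -> : x / Num.sqrt (2 * t) * (e * x / Num.sqrt (2 * t)) = e * (x ^+ 2 / (2 * t)).
  rewrite -[in RHS](sqr_sqrtr (_ : 0 <= 2 * t)); last by rewrite mulr_ge0// ltW.
  by field; rewrite sqrtr_eq0 -ltNge mulr_gt0.
have -> : (x ^+ 2 + (e * x) ^+ 2) / (4 * t) = x ^+ 2 / (2 * t).
  by case: e1 => ->; field; rewrite gt_eqF.
rewrite /kernel_cst /prefactor /kernel_integrand; ring.
Qed.

Lemma heat_kernel_diag_asymp (k : R) : 0 < k ->
  asymp times (fun p => heat_kernel1 k p.1 p.2 p.2)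
    (fun p => (volume_model k p)^-1).
Proof.
move=> k0; have [k1 k2] : -1 < k - 1 /\ -1 < k by split; lra.
have /(@asymp_comp _ _ _ _ times (fun p => p.2 ^+ 2 / (2 * p.1))) J :=
  jacobi_laplace_asymp k1 k2.
rewrite subrK in J.
apply: (@asymp_eql _ _ _ _ (fun p => kernel_cst k * (prefactor k p.1 *
    \int[mu]_(u in `[-1, 1]) jacobi_exp (k - 1) k (p.2 ^+ 2 / (2 * p.1)) u))).
  move=> -[t x]; rewrite /pos_time/= => t0.
  rewrite -[X in heat_kernel1 k t x X]mul1r heat_kernelE//; last by left.
  by rewrite mul1r dunkl_kernel_diag_integral.
apply: asympZ; first exact: kernel_cst_gt0.
apply: asymp_trans (prefactor_asymp k); apply: asympM.
  by apply: asymp_refl => // -[t x] /= t0; exact: powR_gt0.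
by apply: J => -[t x]; rewrite /pos_time/= => t0; rewrite divr_ge0 ?sqr_ge0 ?mulr_ge0 ?ltW.
Qed.

(** The Laplace-type integral now decays like w^(-(k+1)); the additional factor
    1/w is comparable to t/(t+x^2). *)
Lemma heat_kernel_antidiag_asymp (k : R) : 0 < k ->
  asymp times (fun p => heat_kernel1 k p.1 p.2 (- p.2))
    (fun p => (volume_model k p)^-1 * (p.1 / (p.1 + p.2 ^+ 2))).
Proof.
move=> k0; have [k1 k2] : -1 < k - 1 /\ -1 < k by split; lra.
have /(@asymp_comp _ _ _ _ times (fun p => p.2 ^+ 2 / (2 * p.1))) J :=
  jacobi_laplace_asymp k2 k1.
apply: (@asymp_eql _ _ _ _ (fun p => kernel_cst k * (prefactor k p.1 *
    \int[mu]_(u in `[-1, 1]) jacobi_exp k (k - 1) (p.2 ^+ 2 / (2 * p.1)) u))).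
  move=> -[t x]; rewrite /pos_time/= => t0.
  rewrite -[X in heat_kernel1 k t x X]mulN1r heat_kernelE//; last by right.
  by rewrite mulN1r dunkl_kernel_antidiag_integral.
apply: asympZ; first exact: kernel_cst_gt0.
apply: (@asymp_trans _ _ _ _
    (fun p => prefactor k p.1 * w p `^ (- k) * (w p)^-1)).
  apply: (@asymp_eqr _ _ _ _ _ (fun p => prefactor k p.1 * w p `^ (- (k + 1)))).
    move=> -[t x]; rewrite /pos_time/= => t0; rewrite -mulrA; congr *%R.
    have w0 : 0 < w (t, x).
      by rewrite /w/= ltr_wpDr// divr_ge0 ?sqr_ge0 ?mulr_ge0 ?ltW.
    rewrite -(powR_inv1 (ltW w0)) -powRD; last by rewrite (gt_eqF w0) implybT.
    by congr powR; ring.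
  apply: asympM.
    by apply: asymp_refl => // -[t x] /= t0; exact: powR_gt0.
  by apply: J => -[t x]; rewrite /pos_time/= => t0; rewrite divr_ge0 ?sqr_ge0 ?mulr_ge0 ?ltW.
apply: asympM; first exact: prefactor_asymp.
apply: (asymp_eqr _ (asympV w_asymp_dist)) => -[t x] _ /=.
by rewrite invf_div.
Qed.

End heat_kernel.

(** * Volume of balls *)

Section volume.
Context {R : realType}.
Local Notation mu := (@lebesgue_measure R).

(** The points at distance between h/2 and h from x, on the side of x away from
    the origin: there the weight is not small compared with that of x. *)
Definition outer_half (x h : R) : set R :=
  if 0 <= x then `[x + h / 2, x + h[%classic else `]x - h, x - h / 2]%classic.

Lemma measurable_outer_half x h : measurable (outer_half x h).
Proof. by rewrite /outer_half; case: ifP => _; exact: measurable_itv. Qed.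

Lemma lebesgue_outer_half x h : 0 < h -> mu (outer_half x h) = (h / 2)%:E.
Proof.
move=> h0; rewrite /outer_half; case: ifP => _.
  rewrite lebesgue_measure_itv/= lte_fin ifT; last by lra.
  by rewrite -EFinB; congr EFin; field.
rewrite lebesgue_measure_itv/= lte_fin ifT; last by lra.
by rewrite -EFinB; congr EFin; field.
Qed.

Lemma outer_half_dist x h y : 0 < h -> outer_half x h y -> `|x - y| < h.
Proof.
move=> h0; rewrite /outer_half; case: ifP => _ /=; rewrite in_itv/= => /andP[? ?].
  by rewrite ltr_norml; apply/andP; split; lra.
by rewrite ltr_norml; apply/andP; split; lra.
Qed.

Lemma outer_half_norm x h y : 0 < h -> outer_half x h y -> `|x| + h / 2 <= `|y|.
Proof.
move=> h0; rewrite /outer_half; case: ifP => x0 /=; rewrite in_itv/= => /andP[? ?].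
  by rewrite ger0_norm// ler_normr; apply/orP; left; lra.
move: x0; rewrite leNgt => /negbFE x0.
by rewrite ltr0_norm// ler_normr; apply/orP; right; lra.
Qed.

Lemma weight_le (k x y r : R) : 0 <= k -> `|x - y| <= r ->
  `|y| `^ (2 * k) <= (`|x| + r) `^ (2 * k).
Proof.
move=> k0 xyr; apply: ge0_ler_powR; rewrite ?nnegrE ?mulr_ge0//.
  by rewrite addr_ge0// (le_trans _ xyr).
rewrite -[y](subKr x); apply: (le_trans (ler_normB _ _)).
by rewrite lerD2l.
Qed.

(** The radius is divided by N.+1 because in higher dimension the interval is the
    side of a box inscribed in a ball of radius r. *)
Lemma weight_ge (k x y r : R) (N : nat) : 0 <= k -> 0 < r ->
  outer_half x (r / N.+1%:R) y ->
  (2 * N.+1%:R)^-1 `^ (2 * k) * (`|x| + r) `^ (2 * k) <= `|y| `^ (2 * k).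
Proof.
move=> k0 r0; have N0 : (0 : R) < N.+1%:R by rewrite ltr0n.
move=> /(outer_half_norm (divr_gt0 r0 N0)) xy.
have x0 : 0 <= `|x| + r by rewrite addr_ge0 // ltW.
have N20 : 0 <= (2 * N.+1%:R)^-1 :> R by rewrite invr_ge0 mulr_ge0// ltW.
rewrite -powRM//; apply: ge0_ler_powR; rewrite ?nnegrE ?mulr_ge0//.
apply: le_trans xy; rewrite mulrDr; apply: lerD.
  by rewrite ler_piMl// invf_le1 ?mulr_gt0// -natrM ler1n muln_gt0.
by rewrite le_eqVlt; apply/orP; left; apply/eqP; field; rewrite ?gt_eqF.
Qed.

Local Notation times := (@pos_time R R).

Lemma dunkl_measure1_bounds (k x r : R) : 0 <= k -> 0 < r ->
  2^-1 `^ (2 * k) / 2 * (r * (`|x| + r) `^ (2 * k)) <=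
    fine (dunkl_measure1 k (ball x r)) <= 2 * (r * (`|x| + r) `^ (2 * k)).
Proof.
move=> k0 r0; set b := (`|x| + r) `^ (2 * k).
have mf : measurable_fun (ball x r) (fun y : R => (`|y| `^ (2 * k))%:E).
  apply/measurable_EFinP; apply: measurable_funTS.
  by apply: (measurableT_comp (measurable_powR _)); exact: normr_measurable.
have mb : measurable (ball x r : set R) by exact: measurable_ball.
apply: fine_bounds.
  have -> : ((2^-1 `^ (2 * k) / 2 * (r * b))%:E =
      (2^-1 `^ (2 * k) * b)%:E * mu (outer_half x (r / 1%:R)))%E.
    rewrite lebesgue_outer_half ?divr1// -EFinM; congr EFin; ring.
  apply: integral_ge_cst => //.
  - exact: measurable_outer_half.
  - by move=> y /outer_half_dist; rewrite divr1; exact.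
  - by rewrite mulr_ge0 ?powR_ge0.
  - by move=> y /(weight_ge k0 r0); rewrite mulr1.
have -> : ((2 * (r * b))%:E = b%:E * mu (ball x r))%E.
  rewrite lebesgue_measure_ball ?ltW// -EFinM; congr EFin; ring.
apply: integral_le_cst => // y; rewrite /ball/= => xy.
by rewrite powR_ge0 weight_le// ltW.
Qed.

Lemma volume_model_gt0 (k : R) (p : R * R) : times p -> 0 < volume_model k p.
Proof.
move=> t0; rewrite mulr_gt0 ?sqrtr_gt0// powR_gt0//.
by rewrite ltr_wpDl// sqrtr_gt0.
Qed.

Lemma dunkl_measure1_asymp (k : R) : 0 <= k ->
  asymp times (fun p => fine (dunkl_measure1 k (ball p.2 (Num.sqrt p.1))))
    (volume_model k).
Proof.
move=> k0; have bnd p : times p -> _ :=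
  fun t0 => dunkl_measure1_bounds p.2 k0 (etrans (sqrtr_gt0 p.1) t0).
apply: (@asymp_bounds _ _ _ _ _ (2^-1 `^ (2 * k) / 2) 2) => // [p|p|p].
- exact: volume_model_gt0.
- by move=> /bnd/andP[].
- by move=> /bnd/andP[].
Qed.

End volume.

Section product.
Context {R : realType} (n : nat).
Local Notation rT := (measurableTypeR R).
Local Notation mu := (@lebesgue_tuple R n).

Definition box (A : 'I_n -> set R) : set (n.-tuple rT) :=
  [set x | forall j, A j (tnth x j)].

Lemma measurable_box (A : 'I_n -> set R) : (forall j, measurable (A j)) ->
  measurable (box A).
Proof.
move=> mA; rewrite (_ : box A = \bigcap_(j in [set: 'I_n])
    ((fun x : n.-tuple rT => tnth x j) @^-1` A j)); last first.
  by apply/seteqP; split=> x /= h j; [move=> _; exact: h|exact: (h j)].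
apply: fin_bigcap_measurable => //= j _.
by rewrite -[X in measurable X]setTI; exact: (@measurable_tnth _ rT n j measurableT _ (mA j)).
Qed.

Lemma measurable_eucl_ball (x : n.-tuple R) (r : R) :
  measurable (eucl_ball x r : set (n.-tuple rT)).
Proof.
have md : measurable_fun setT (fun y : n.-tuple rT => eucl_dist x y : R).
  have ms : measurable_fun setT (@Num.sqrt R).
    by apply: continuous_measurable_fun; exact: sqrt_continuous.
  rewrite /eucl_dist; apply: (measurableT_comp ms).
  apply: measurable_sum => j; apply: measurable_funX; apply: measurable_funB => //.
  exact: measurable_tnth.
rewrite (_ : eucl_ball x r = (fun y => eucl_dist x y) @^-1` `]-oo, r[%classic).
  by rewrite -[X in measurable X]setTI; exact: md.
by apply/seteqP; split => y; rewrite /eucl_ball/= in_itv.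
Qed.

Lemma eucl_ball_sub_box (x : n.-tuple R) (r : R) :
  eucl_ball x r `<=` box (fun j => ball (tnth x j) r).
Proof.
move=> y; rewrite /eucl_ball/= => xy j; rewrite /ball/=.
apply: le_lt_trans xy; rewrite -sqrtr_sqr /eucl_dist; apply: ler_wsqrtr.
by rewrite (bigD1 j)//= lerDl sumr_ge0// => i _; rewrite sqr_ge0.
Qed.

(** Sides of length r/(n+1) suffice: n (r/(n+1))^2 < r^2. *)
Lemma box_sub_eucl_ball (x : n.-tuple R) (r : R) : 0 < r ->
  box (fun j => outer_half (tnth x j) (r / n.+1%:R)) `<=` eucl_ball x r.
Proof.
move=> r0 y xy; rewrite /eucl_ball/= /eucl_dist.
have N0 : (0 : R) < n.+1%:R by rewrite ltr0n.
rewrite -[ltRHS](ger0_norm (ltW r0)) -sqrtr_sqr ltr_sqrt ?exprn_gt0//.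
apply: (@le_lt_trans _ _ (\sum_(j < n) (r / n.+1%:R) ^+ 2)).
  apply: ler_sum => j _; rewrite -[leLHS]real_normK ?num_real//.
  rewrite ler_sqr ?nnegrE ?(ltW (divr_gt0 r0 N0))//; apply: ltW.
  exact: (outer_half_dist (divr_gt0 r0 N0) (xy j)).
rewrite sumr_const card_ord -[_ *+ n]mulr_natl exprMn mulrCA gtr_pMr ?exprn_gt0//.
rewrite exprVn ltr_pdivrMr ?exprn_gt0// mul1r -natrX ltr_nat.
by rewrite expnS expn1 mulSn ltnS leq_addr.
Qed.

(** Lower bound: integrate over the box of outer intervals inside the ball. Upper
    bound: the ball is contained in a box of sides 2r. *)
Lemma dunkl_measure_bounds (k : 'I_n -> R) (x : n.-tuple R) (r : R) :
  (forall j, 0 <= k j) -> 0 < r ->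
  (\prod_(j < n) ((2 * n.+1%:R)^-1 `^ (2 * k j) * (n.+1%:R^-1 / 2))) *
    \prod_(j < n) (r * (`|tnth x j| + r) `^ (2 * k j)) <=
  fine (dunkl_measure k (eucl_ball x r)) <=
  2 ^+ n * \prod_(j < n) (r * (`|tnth x j| + r) `^ (2 * k j)).
Proof.
move=> k0 r0; have N0 : (0 : R) < n.+1%:R by rewrite ltr0n.
have rN0 : 0 < r / n.+1%:R by exact: divr_gt0.
pose f (y : n.-tuple rT) : R := \prod_(j < n) `|tnth y j| `^ (2 * k j).
have mf : measurable_fun (eucl_ball x r : set (n.-tuple rT)) (fun y => (f y)%:E).
  apply/measurable_EFinP; apply: measurable_funTS.
  apply: measurable_prod => j _; apply: (measurableT_comp (measurable_powR _)).
  by apply: (measurableT_comp (@normr_measurable R setT)); exact: measurable_tnth.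
have mE := measurable_eucl_ball x r.
have mO j : measurable (outer_half (tnth x j) (r / n.+1%:R)).
  exact: measurable_outer_half.
have mB j : measurable (ball (tnth x j) r : set R) by exact: measurable_ball.
apply: fine_bounds.
  set m := \prod_(j < n) ((2 * n.+1%:R)^-1 `^ (2 * k j) *
    (`|tnth x j| + r) `^ (2 * k j)).
  have -> : ((\prod_(j < n) ((2 * n.+1%:R)^-1 `^ (2 * k j) * (n.+1%:R^-1 / 2)) *
      \prod_(j < n) (r * (`|tnth x j| + r) `^ (2 * k j)))%:E =
      m%:E * mu (box (fun j => outer_half (tnth x j) (r / n.+1%:R))))%E.
    rewrite lebesgue_tuple_box//.
    rewrite (eq_bigr (fun=> (r / n.+1%:R / 2)%:E)); last first.
      by move=> j _; exact: lebesgue_outer_half.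
    rewrite prodEFin -EFinM -!big_split/=; congr EFin.
    by apply: eq_bigr => j _; ring.
  apply: integral_ge_cst => //.
  - exact: measurable_box.
  - exact: box_sub_eucl_ball.
  - by move=> y _; rewrite prodr_ge0// => j _; rewrite powR_ge0.
  - by rewrite prodr_ge0// => j _; rewrite mulr_ge0 ?powR_ge0.
  - move=> y xy; apply: ler_prod => j _; rewrite mulr_ge0 ?powR_ge0//=.
    exact: weight_ge.
set M := \prod_(j < n) (`|tnth x j| + r) `^ (2 * k j).
apply: (@le_trans _ _ (M%:E * mu (eucl_ball x r))%E).
  apply: integral_le_cst => // y /eucl_ball_sub_box xy; apply/andP; split.
    by rewrite prodr_ge0// => j _; rewrite powR_ge0.
  apply: ler_prod => j _; rewrite powR_ge0/= weight_le//.
  exact: ltW (xy j).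
have -> : (2 ^+ n * \prod_(j < n) (r * (`|tnth x j| + r) `^ (2 * k j)))%:E =
    (M%:E * mu (box (fun j => ball (tnth x j) r)))%E.
  rewrite lebesgue_tuple_box//.
  rewrite (eq_bigr (fun=> (r *+ 2)%:E)); last first.
    by move=> j _; rewrite lebesgue_measure_ball ?(ltW r0).
  rewrite prodEFin -EFinM; congr EFin.
  have -> : 2 ^+ n = \prod_(j < n) 2 :> R by rewrite prodr_const card_ord.
  rewrite -!big_split/=.
  by apply: eq_bigr => j _; ring.
apply: lee_wpmul2l; first by rewrite lee_fin prodr_ge0// => j _; rewrite powR_ge0.
apply: le_measure; rewrite ?inE//; first exact: measurable_box.
exact: eucl_ball_sub_box.
Qed.

End product.

(** * The product case *)

Section product_asymp.
Context {R : realType} (n : nat) (k : 'I_n -> R).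
Hypothesis k_gt0 : forall j, 0 < k j.

Local Notation times := (@pos_time R (n.-tuple R)).

Lemma dunkl_measure_asymp :
  asymp times (fun p => fine (dunkl_measure k (eucl_ball p.2 (Num.sqrt p.1))))
    (fun p => \prod_(j < n) volume_model (k j) (p.1, tnth p.2 j)).
Proof.
have bnd p : times p -> _ := fun t0 =>
  dunkl_measure_bounds p.2 (fun j => ltW (k_gt0 j)) (etrans (sqrtr_gt0 p.1) t0).
apply: (asymp_bounds (c := \prod_(j < n)
  ((2 * n.+1%:R)^-1 `^ (2 * k j) * (n.+1%:R^-1 / 2))) (C := 2 ^+ n)).
- apply: prodr_gt0 => j _.
  by rewrite mulr_gt0 ?powR_gt0 ?divr_gt0 ?invr_gt0 ?mulr_gt0 ?ltr0n.
- exact: exprn_gt0.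
- by move=> p t0; apply: prodr_gt0 => j _; exact: volume_model_gt0.
- by move=> p /bnd/andP[].
- by move=> p /bnd/andP[].
Qed.

(** Only the first factor is off the diagonal, and it carries the damping
    t/(t+x_1^2), comparable to t/(t+4 x_1^2). *)
Lemma heat_kernel_flip_asymp : (0 < n)%N ->
  asymp times (fun p => heat_kernel k p.1 p.2 (flip_first p.2))
    (fun p => (\prod_(j < n) volume_model (k j) (p.1, tnth p.2 j))^-1 *
      (p.1 / (p.1 + eucl_dist p.2 (flip_first p.2) ^+ 2))).
Proof.
move=> n0; pose i0 : 'I_n := Ordinal n0.
pose damp (j : 'I_n) (p : R * n.-tuple R) : R :=
  if j == i0 then p.1 / (p.1 + tnth p.2 j ^+ 2) else 1.
have flipE (x : n.-tuple R) j :
    tnth (flip_first x) j = if j == i0 then - tnth x j else tnth x j.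
  by rewrite tnth_mktuple.
have distE (x : n.-tuple R) : eucl_dist x (flip_first x) ^+ 2 = 4 * tnth x i0 ^+ 2.
  rewrite /eucl_dist sqr_sqrtr; last by apply: sumr_ge0 => j _; exact: sqr_ge0.
  rewrite (bigD1 i0)//= big1 ?addr0; last first.
    by move=> j /negbTE ji0; rewrite flipE ji0 subrr expr0n.
  by rewrite flipE eqxx; ring.
apply: (@asymp_trans _ _ _ _ (fun p => \prod_(j < n)
    ((volume_model (k j) (p.1, tnth p.2 j))^-1 * damp j p))).
  apply: asymp_prod => j.
  pose coord (p : R * n.-tuple R) : R * R := (p.1, tnth p.2 j).
  have ct p : times p -> @pos_time R R (coord p) by [].
  have [ji0|ji0] := eqVneq j i0.
    apply: (asymp_eql _ (asymp_eqr _
      (asymp_comp ct (heat_kernel_antidiag_asymp (k_gt0 j))))) => p _; rewrite /coord/=.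
      by rewrite flipE ji0 eqxx.
    by rewrite /damp /coord/= ji0 eqxx.
  apply: (asymp_eql _ (asymp_eqr _
    (asymp_comp ct (heat_kernel_diag_asymp (k_gt0 j))))) => p _ /=.
    by rewrite flipE (negbTE ji0).
  by rewrite /damp (negbTE ji0) mulr1.
apply: (@asymp_eql _ _ _ _ (fun p =>
    (\prod_(j < n) volume_model (k j) (p.1, tnth p.2 j))^-1 *
    (p.1 / (p.1 + tnth p.2 i0 ^+ 2)))).
  move=> p _; rewrite big_split/= prodfV; congr *%R.
  rewrite (bigD1 i0)//= big1 ?mulr1; last by move=> j /negbTE ji0; rewrite /damp ji0.
  by rewrite /damp eqxx.
apply: asympM.
  apply: asymp_refl => // p t0; rewrite invr_gt0.
  by apply: prodr_gt0 => j _; exact: volume_model_gt0.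
apply: (@asymp_bounds _ _ _ _ _ 1 4) => //.
- move=> p t0; rewrite distE divr_gt0// ltr_wpDr//.
  by rewrite mulr_ge0 ?sqr_ge0.
all: move=> [t x]; rewrite /pos_time/= => t0; rewrite distE.
all: have s0 := sqr_ge0 (tnth x i0).
all: have d1 : 0 < t + tnth x i0 ^+ 2 by rewrite ltr_wpDr.
all: have d2 : 0 < t + 4 * tnth x i0 ^+ 2 by rewrite ltr_wpDr// mulr_ge0.
  by rewrite mul1r ler_pM2l// lef_pV2 ?posrE//; lra.
rewrite mulrCA ler_pM2l// ler_pdivlMr// mulrC ler_pdivrMr//; lra.
Qed.

End product_asymp.

Theorem mainTheorem3 (R : realType) :
  (forall k : R, 0 < k ->
     (exists2 C : R, 0 < C & forall t x : R, 0 < t ->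
        let V := fine (dunkl_measure1 k (ball x (Num.sqrt t))) in
        C^-1 * V^-1 <= heat_kernel1 k t x x <= C * V^-1) /\
     (exists2 C : R, 0 < C & forall t x : R, 0 < t ->
        let V := fine (dunkl_measure1 k (ball x (Num.sqrt t))) in
        C^-1 * (V^-1 * (t / (t + x ^+ 2))) <= heat_kernel1 k t x (- x)
          <= C * (V^-1 * (t / (t + x ^+ 2))))) /\
  (forall (n : nat) (k : 'I_n -> R), (1 <= n)%N -> (forall j, 0 < k j) ->
     exists2 C : R, 0 < C & forall (t : R) (x : n.-tuple R), 0 < t ->
       let y := flip_first x in
       let V := fine (dunkl_measure k (eucl_ball x (Num.sqrt t))) in
       C^-1 * (V^-1 * (t / (t + eucl_dist x y ^+ 2))) <= heat_kernel k t x y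
         <= C * (V^-1 * (t / (t + eucl_dist x y ^+ 2)))).
Proof.
split=> [k k0|n k n0 k0].
  have V1 := asympV (asymp_sym (dunkl_measure1_asymp (ltW k0))).
  split.
    have [C C0 h] := asymp_trans (heat_kernel_diag_asymp k0) V1.
    by exists C => // t x t0; have [_] := h (t, x) t0.
  have D1 : asymp (@pos_time R R) (fun p => p.1 / (p.1 + p.2 ^+ 2))
      (fun p => p.1 / (p.1 + p.2 ^+ 2)).
    by apply: asymp_refl => // -[t x]/= t0; rewrite divr_gt0// ltr_wpDr// sqr_ge0.
  have [C C0 h] := asymp_trans (heat_kernel_antidiag_asymp k0) (asympM V1 D1).
  by exists C => // t x t0; have [_] := h (t, x) t0.
have V := asympV (asymp_sym (dunkl_measure_asymp k0)).
have Dn : asymp (@pos_time R (n.-tuple R))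
    (fun p => p.1 / (p.1 + eucl_dist p.2 (flip_first p.2) ^+ 2))
    (fun p => p.1 / (p.1 + eucl_dist p.2 (flip_first p.2) ^+ 2)).
  by apply: asymp_refl => // -[t x]/= t0; rewrite divr_gt0// ltr_wpDr// sqr_ge0.
have [C C0 h] := asymp_trans (heat_kernel_flip_asymp k0 n0) (asympM V Dn).
by exists C => // t x t0; have [_] := h (t, x) t0.
Qed.
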